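(* Let $0<q\le\infty$ and $1<p<\infty$. For every non-negative $L_{p,q}$-bounded submartingale $(f_n)_{n\in\mathbb{N}}$ with respect to the dyadic filtration $(\mathcal{F}_n)_{n\in\mathbb{N}}$, one has $$\left\|\sup_{n\in\mathbb{N}}f_n\right\|_{p,q}\le\frac{p}{p-1}\,\sup_{n\in\mathbb{N}}\|f_n\|_{p,q}.$$
   Context: Setting: for $n\in\mathbb{N}=\{0,1,2,\dots\}$, $\mathcal{F}_n$ is the $\sigma$-algebra on $\mathbb{R}$ generated by the dyadic intervals $[k2^{-n},(k+1)2^{-n})$, $k\in\mathbb{Z}$; $\mathcal{F}$ is the $\sigma$-algebra generated by $\bigcup_n\mathcal{F}_n$; $\mathbb{P}$ is a probability measure on $(\mathbb{R},\mathcal{F})$. Put $A_j=[j,j+1)$, $j\in\mathbb{Z}$. Amalgam (quasi-)norm: $\|f\|_{p,q}=\|f\|_{L_{p,q}(\mathbb{R})}=\left(\sum_{j\in\mathbb{Z}}\left(\int_{A_j}|f|^p\,d\mathbb{P}\right)^{q/p}\right)^{1/q}$ for $0<p,q<\infty$, and $\|f\|_{p,\infty}=\sup_{j\in\mathbb{Z}}\left(\int_{A_j}|f|^p\,d\mathbb{P}\right)^{1/p}$. A sequence $(f_n)$ is $L_{p,q}$-bounded if $\sup_n\|f_n\|_{p,q}<\infty$. *)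

(* Defs.v *)
From HB Require Import structures.
From mathcomp Require Import all_boot all_order all_algebra.
From mathcomp Require Import all_classical all_reals all_analysis.

Set Implicit Arguments.
Unset Strict Implicit.
Unset Printing Implicit Defensive.

Import Order.TTheory GRing.Theory Num.Theory.
Import numFieldNormedType.Exports.

Local Open Scope classical_set_scope.
Local Open Scope ring_scope.

Section dyadic_filtration.
Variable R : realType.

Definition dyadic_interval (n : nat) (k : int) : set R :=
  `[k%:~R / 2 ^+ n, (k + 1)%:~R / 2 ^+ n[.

Definition dyadic_salgebra (n : nat) : set (set R) :=
  <<s range (dyadic_interval n) >>.

Definition dyadic_real : measurableType _ :=
  g_sigma_algebraType (\bigcup_n dyadic_salgebra n).

Definition unit_interval (j : int) : set R := `[j%:~R, (j + 1)%:~R[.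

End dyadic_filtration.

Section submartingale.
Context d (T : measurableType d) (R : realType) (P : probability T R).

(* The set system [G] is meant to be a sub-sigma-algebra of [measurable]. *)
Definition measurable_wrt (G : set (set T)) (g : T -> R) : Prop :=
  preimage_set_system setT g measurable `<=` G.

(* [g] is a version of E(X | G); X is meant to be integrable. *)
Definition is_cond_expectation (G : set (set T)) (X g : T -> R) : Prop :=
  [/\ measurable_wrt G g,
      P.-integrable setT (EFin \o g) &
      forall A, G A ->
        (\int[P]_(x in A) (g x)%:E = \int[P]_(x in A) (X x)%:E)%E].

(* Conditional expectations exist and are a.e. unique, so it is immaterial
   whether one or every version of E(f (n+1) | F n) is required to
   dominate f n. *)
Definition submartingale (F : nat -> set (set T)) (f : nat -> T -> R) : Prop :=
  [/\ forall n, measurable_wrt (F n) (f n),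
      forall n, P.-integrable setT (EFin \o f n) &
      forall n, exists2 g, is_cond_expectation (F n) (f n.+1) g &
                           {ae P, forall x, f n x <= g x}].

End submartingale.

Section amalgam_norm.
Context (R : realType) (P : probability (dyadic_real R) R).
Local Open Scope ereal_scope.

(* Functions are extended-real valued because suprema of sequences are; only
   the values at 0 < p and 0 < q <= +oo are meaningful. *)
Definition amalgam_norm (p : R) (q : \bar R) (f : dyadic_real R -> \bar R)
    : \bar R :=
  let I j := \int[P]_(x in @unit_interval R j) (`|f x| `^ p) in
  match q with
  | r%:E => (\esum_(j in [set: int]) (I j `^ (r / p))) `^ r^-1
  | +oo => ereal_sup (range (fun j : int => I j `^ p^-1))
  | -oo => 0
  end.

End amalgam_norm.

(* Main.v *)
Require Import Defs.
From mathcomp Require Import all_boot all_order all_algebra.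
From mathcomp Require Import all_classical all_reals all_analysis.
From mathcomp Require Import measurable_realfun ring lra.

Import Order.TTheory GRing.Theory Num.Theory.
Import numFieldNormedType.Exports.

Local Open Scope classical_set_scope.
Local Open Scope ring_scope.

(* Since each unit interval [A = [j, j+1)] belongs to [F 0], Doob's maximal
   inequality can be localized to [A].  Let [M n] be the running maximum of
   [f 0, ..., f n]; Young's inequality gives the pathwise bound

     (p-1) M_{n+1}^p + p M_n^(p-1) f_{n+1}
       <= p M_{n+1}^(p-1) f_{n+1} + (p-1) M_n^p,

   and, [M n ^ (p-1)] being adapted, the submartingale property yields by
   induction [(p-1) E_A(M_n^p) <= p E_A(M_n^(p-1) f_n)].  A second use of
   Young's inequality gives [E_A(M_n^p) <= (p/(p-1))^p E_A(f_n^p)].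
   Also by Young's inequality, [E_A(f_n^p)] is nondecreasing in [n]; monotone
   convergence therefore lets the supremum over [n] be exchanged with both the
   integral over [A] and the sum over [j]. *)

(** * Young's inequality for powers *)

(** The conjugate exponents are [p / (p - 1)] and [p], applied to [a ^ (p - 1)] and [b]; multiplying
    by [p] clears the denominators. *)
Lemma young_powR {R : realType} {p a b : R} : 1 < p -> 0 <= a -> 0 <= b ->
  p * (a `^ (p - 1) * b) <= (p - 1) * a `^ p + b `^ p.
Proof.
move=> p1 a0 b0; have p10 : 0 < p - 1 by rewrite subr_gt0.
have p0 : 0 < p by lra.
have pp : (p / (p - 1))^-1 + p^-1 = 1 by field; rewrite !gt_eqF.
have := @conjugate_powR _ _ b _ _ (powR_ge0 a (p - 1)) b0 (divr_gt0 p0 p10) p0 pp.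
rewrite -powRrM [(p - 1) * _]mulrC divfK ?gt_eqF// => h.
have -> : (p - 1) * a `^ p + b `^ p
    = p * (a `^ p / (p / (p - 1)) + b `^ p / p) by field; rewrite !gt_eqF.
by rewrite ler_pM2l.
Qed.

(** * Functions measurable for a sub-sigma-algebra, as weights in integrals *)

Section measurable_wrt.
Import HBNNSimple.
Context {d} {T : measurableType d} {R : realType}.
Context {G : set (set T)} (sG : sigma_algebra setT G).

(** A sigma-algebra [G] generates only itself, so adaptedness becomes ordinary measurability on
    another measurable type, with all its closure properties. *)
Lemma measurable_wrtP {g : T -> R} : measurable_wrt G g <->
  measurable_fun setT (g : g_sigma_algebraType G -> R).
Proof.
split=> [Gg _ Y mY|mg _ [Y mY <-]].
  by apply: sub_sigma_algebra; apply: Gg; exists Y.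
by rewrite -(sigma_algebra_id sG); exact: mg.
Qed.

Lemma measurable_wrt_max {g h : T -> R} : measurable_wrt G g ->
  measurable_wrt G h -> measurable_wrt G (fun x => Num.max (g x) (h x)).
Proof.
by rewrite !measurable_wrtP => mg mh; exact: measurable_maxr.
Qed.

Lemma measurable_wrt_powR {g : T -> R} (r : R) : measurable_wrt G g ->
  measurable_wrt G (fun x => g x `^ r).
Proof.
rewrite !measurable_wrtP => mg.
exact: (@measurableT_comp _ _ _ _ _ _ (@powR R ^~ r) _ (g : g_sigma_algebraType G -> R)).
Qed.

Lemma measurable_wrt_measurable {g : T -> R} : G `<=` measurable ->
  measurable_wrt G g -> measurable_fun setT g.
Proof. by move=> GT Gg _ Y mY; apply: GT; apply: Gg; exists Y. Qed.

Local Open Scope ereal_scope.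

(** For a simple weight, this is a nonnegative combination of the inequalities on the intersections
    of [A] with the level sets, which lie in [G]. A general weight is an increasing limit of simple
    ones. *)
Lemma le_integral_mul_wrt (mu : {measure set T -> \bar R}) (X Y phi : T -> R) :
  G `<=` measurable ->
  (forall x, (0 <= X x)%R) -> (forall x, (0 <= Y x)%R) ->
  (forall x, (0 <= phi x)%R) ->
  measurable_fun setT X -> measurable_fun setT Y -> measurable_wrt G phi ->
  (forall B, G B ->
    \int[mu]_(x in B) (X x)%:E <= \int[mu]_(x in B) (Y x)%:E) ->
  forall A, G A ->
  \int[mu]_(x in A) (phi x * X x)%:E <= \int[mu]_(x in A) (phi x * Y x)%:E.
Proof.
move=> GT X0 Y0 phi0 mX mY Gphi XY A GA.
have mA : measurable A := GT _ GA.
have mphi := measurable_wrt_measurable GT Gphi.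
have GI B C : G B -> G C -> G (B `&` C).
  rewrite -(sigma_algebra_id sG) => mB mC.
  exact: (@measurableI _ (g_sigma_algebraType G)).
have /measurable_EFinP mphi' := (@measurable_wrtP phi).1 Gphi.
(* The approximation is taken on the space equipped with [G], so that the level sets of [h n] belong
   to [G]. *)
pose h := nnsfun_approx measurableT mphi'.
have h0 n x : (0 <= h n x)%R by exact: fun_ge0.
have Gh n : measurable_wrt G (h n).
  by apply/measurable_wrtP; exact: measurable_funP.
have mh n := measurable_wrt_measurable GT (Gh n).
have hphi x : (EFin \o h ^~ x) @ \oo --> (phi x)%:E.
  by apply: (cvg_nnsfun_approx measurableT mphi') => // y _; rewrite lee_fin.
have ndh x : nondecreasing_seq (h ^~ x).
  by move=> m n mn; have /lefP := nd_nnsfun_approx measurableT mphi' mn; apply.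
have hle n x : (h n x <= phi x)%R.
  rewrite -lee_fin; apply: cvge_ge (hphi x).
  by exists n => // m /= nm; rewrite lee_fin; exact: ndh.
have simpleE (Z : T -> R) (n : nat) : (forall x, (0 <= Z x)%R) -> measurable_fun setT Z ->
    \int[mu]_(x in A) (h n x * Z x)%:E =
    \sum_(y \in range (h n)) (y%:E *
      \int[mu]_(x in A `&` h n @^-1` [set y]) (Z x)%:E).
  move=> Z0 mZ; have mhY y : d.-measurable (h n @^-1` [set y]).
    by rewrite -[X in d.-measurable X]setTI; exact: mh.
  transitivity (\int[mu]_(x in A) (\sum_(y \in range (h n))
      (y * Z x * \1_(h n @^-1` [set y]) x)%:E)).
    apply: eq_integral => x _; rewrite fsumEFin// (fimfunE (h n)); congr EFin.
    rewrite !fsbig_finite//= mulr_suml.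
    by apply: eq_bigr => y _; rewrite mulrAC.
  (* Here [y] may be negative, but where the indicator is nonzero [y] equals [h n x]. *)
  have yh0 (y : R) x : (0 <= y * Z x * \1_(h n @^-1` [set y]) x)%R.
    rewrite indicE; case: (boolP (x \in _)) => [|_]; last by rewrite mulr0.
    by rewrite inE /= => <-; rewrite mulr1 mulr_ge0.
  rewrite (@ge0_integral_fsum _ _ _ mu A mA R
    (fun y x => (y * Z x * \1_(h n @^-1` [set y]) x)%:E))//=; last 2 first.
  - move=> y; apply/measurable_EFinP/measurable_funTS.
    apply: measurable_funM; last exact: measurable_indic.
    exact: measurable_funM.
  - by move=> y x _; rewrite lee_fin.
  apply: eq_fsbigr => y; rewrite inE => -[t _ <-].
  rewrite integral_mkcondr -ge0_integralZl//; last 3 first.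
  - apply: measurable_funTS; apply/(measurable_restrictT _ _).1 => //.
    exact/measurable_EFinP/measurable_funTS.
  - by move=> x _; rewrite patchE; case: ifPn => // _; rewrite lee_fin.
  - by rewrite lee_fin.
  apply: eq_integral => x _.
  rewrite patchE indicE; case: (boolP (x \in _)) => _; first by rewrite mulr1.
  by rewrite mulr0 mule0.
(* The weight on the right is enlarged to [phi] at once, so only the left-hand side has to go to the
   limit. *)
have le_h n : \int[mu]_(x in A) (h n x * X x)%:E
    <= \int[mu]_(x in A) (phi x * Y x)%:E.
  rewrite simpleE//; apply: (@le_trans _ _ (\int[mu]_(x in A) (h n x * Y x)%:E)).
    rewrite simpleE//; apply: lee_fsum => // _ [t _ <-].
    rewrite lee_wpmul2l ?lee_fin// XY//; apply: (GI _ _ GA).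
    by apply: Gh; exists [set h n t]; rewrite ?setTI.
  apply: ge0_le_integral => //.
  - by move=> x _; rewrite lee_fin mulr_ge0.
  - by apply/measurable_EFinP/measurable_funTS; exact: measurable_funM.
  - by apply/measurable_EFinP/measurable_funTS; exact: measurable_funM.
  - by move=> x _; rewrite lee_fin ler_wpM2r.
have hXphi x : (h n x * X x)%:E @[n --> \oo] --> (phi x * X x)%:E.
  under eq_fun do rewrite EFinM; rewrite EFinM.
  exact: cvgeZr (hphi x).
have mhX n : measurable_fun A (fun x => (h n x * X x)%:E).
  by apply/measurable_EFinP/measurable_funTS; exact: measurable_funM.
have nd_hX x : nondecreasing_seq (fun n => (h n x * X x)%:E).
  by move=> m n mn; rewrite lee_fin ler_wpM2r//; exact: ndh.
rewrite [leLHS](_ : _ = \int[mu]_(x in A) limn (fun n => (h n x * X x)%:E)).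
  have hX0 n x : A x -> 0 <= (h n x * X x)%:E.
    by move=> _; rewrite lee_fin mulr_ge0.
  have := @cvg_monotone_convergence _ _ _ mu A mA
    (fun n x => (h n x * X x)%:E) mhX hX0 (fun x _ => nd_hX x).
  by apply: cvge_le; exact: nearW.
by apply: eq_integral => x _; apply/esym/cvg_lim.
Qed.

End measurable_wrt.

(** * Powers and suprema of extended reals *)

Section poweR_ereal_sup.
Context {R : realType}.
Local Open Scope ereal_scope.

Lemma le_poweR (s : R) (x y : \bar R) : (0 <= s)%R -> 0 <= x -> x <= y ->
  x `^ s <= y `^ s.
Proof.
move=> s0 x0 xy.
by apply: gt0_ler_poweR => //; rewrite in_itv/= leey andbT// (le_trans x0).
Qed.

Lemma poweRK (s : R) (x : \bar R) : s != 0%R -> 0 <= x ->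
  (x `^ s) `^ s^-1 = x.
Proof. by move=> s0 x0; rewrite -poweRrM mulfV// poweRe1. Qed.

Lemma poweRVK (s : R) (x : \bar R) : s != 0%R -> 0 <= x ->
  (x `^ s^-1) `^ s = x.
Proof. by move=> s0 x0; rewrite -poweRrM mulVf// poweRe1. Qed.

(** On nonnegative extended reals the power [s] is increasing, with the increasing inverse [s^-1].
    The index [i0] excludes the empty family, whose supremum is negative. *)
Lemma poweR_ereal_sup {I : Type} (i0 : I) (s : R) (u : I -> \bar R) :
  (0 < s)%R -> (forall i, 0 <= u i) ->
  ereal_sup (range u) `^ s = ereal_sup (range (fun i => u i `^ s)).
Proof.
move=> s0 u0; apply/eqP; rewrite eq_le; apply/andP; split; last first.
  apply: ge_ereal_sup => _ [i _ <-]; apply: le_poweR => //; first exact: ltW.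
  by apply: ereal_sup_ubound; exists i.
set K := ereal_sup (range (fun i => u i `^ s)).
have K0 : 0 <= K.
  by apply: le_trans (poweR_ge0 (u i0) s) _; apply: ereal_sup_ubound; exists i0.
rewrite -[K](@poweRVK s) ?gt_eqF//; apply: le_poweR; first exact: ltW.
  by apply: le_trans (u0 i0) _; apply: ereal_sup_ubound; exists i0.
apply: ge_ereal_sup => _ [i _ <-].
rewrite -[u i](@poweRK s) ?gt_eqF//; apply: le_poweR.
- by rewrite invr_ge0 ltW.
- exact: poweR_ge0.
- by apply: ereal_sup_ubound; exists i.
Qed.

End poweR_ereal_sup.

(** * The running maximum *)

Fixpoint running_max {T : Type} {R : realType} (f : nat -> T -> R) (n : nat)
    (x : T) : R :=
  if n is m.+1 then Num.max (running_max f m x) (f n x) else f 0%N x.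

Section running_max.
Context {T : Type} {R : realType} (f : nat -> T -> R).
Local Notation M := (running_max f).

Lemma le_running_max n x : f n x <= M n x.
Proof. by case: n => //= n; rewrite le_max lexx orbT. Qed.

Lemma nondecreasing_running_max x : nondecreasing_seq (M ^~ x).
Proof. by apply/nondecreasing_seqP => n /=; rewrite le_max lexx. Qed.

Lemma running_max_ge0 n x : (forall n x, 0 <= f n x) -> 0 <= M n x.
Proof. by move=> f0; exact: le_trans (f0 n x) (le_running_max n x). Qed.

(** Allows [f] to be replaced by a nondecreasing sequence, to which monotone convergence applies. *)
Lemma ereal_sup_running_max x :
  ereal_sup (range (fun n => (M n x)%:E)) =
  ereal_sup (range (fun n => (f n x)%:E)).
Proof.
apply/eqP; rewrite eq_le; apply/andP; split.
  apply: ge_ereal_sup => _ [n _ <-]; elim: n => [|n IHn] /=.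
    by apply: ereal_sup_ubound; exists 0%N.
  rewrite EFin_max ge_max IHn /=.
  by apply: ereal_sup_ubound; exists n.+1.
apply: ge_ereal_sup => _ [n _ <-].
apply: (@le_trans _ _ (M n x)%:E); first by rewrite lee_fin le_running_max.
by apply: ereal_sup_ubound; exists n.
Qed.

End running_max.

(** If [b <= a] both sides coincide; otherwise the maximum is [b], and the claim reduces to Young's
    inequality. *)
Lemma running_max_step {R : realType} {p a b : R} : 1 < p -> 0 <= a -> 0 <= b ->
  (p - 1) * Num.max a b `^ p + p * (a `^ (p - 1) * b)
  <= p * (Num.max a b `^ (p - 1) * b) + (p - 1) * a `^ p.
Proof.
move=> p1 a0 b0; case: (leP b a) => ab; first by rewrite addrC.
have pb : b `^ (p - 1) * b = b `^ p by rewrite mulrC mulr_powRB1//; lra.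
have := young_powR p1 a0 b0; rewrite pb; lra.
Qed.

(** * Doob's maximal inequality on a set of the initial sigma-algebra *)

Section doob.
Context {d} {T : measurableType d} {R : realType}.
Context (mu : {measure set T -> \bar R}) (F : nat -> set (set T)).
Context (f : nat -> T -> R) (A : set T) (p : R).
Context (sF : forall n, sigma_algebra setT (F n)).
Context (FT : forall n, F n `<=` measurable).
Context (F_nd : forall n, F n `<=` F n.+1).
Context (fF : forall n, measurable_wrt (F n) (f n)).
Context (f0 : forall n x, 0 <= f n x).
Context (le_f : forall n B, F n B ->
  (\int[mu]_(x in B) (f n x)%:E <= \int[mu]_(x in B) (f n.+1 x)%:E)%E).
Context (FA0 : F 0%N A) (p1 : 1 < p).
Context (f_lty : forall n, (\int[mu]_(x in A) (f n x `^ p)%:E < +oo)%E).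

Local Notation M := (running_max f).
Local Notation "''E' u" := (\int[mu]_(x in A) (u x)%:E)%E (at level 10, u at level 9).

Let p0 : 0 < p. Proof. exact: lt_trans ltr01 p1. Qed.

Let p10 : 0 < p - 1. Proof. by rewrite subr_gt0. Qed.

Let FA n : F n A. Proof. by elim: n => [//|n]; exact: F_nd. Qed.

Let mA : measurable A. Proof. exact: FT (FA 0%N). Qed.

Let mf n : measurable_fun setT (f n).
Proof. exact: measurable_wrt_measurable (FT n) (fF n). Qed.

Lemma running_max_adapted n : measurable_wrt (F n) (M n).
Proof.
elim: n => [|n IHn]; first exact: fF.
apply: measurable_wrt_max => //; exact: subset_trans IHn (F_nd n).
Qed.

Let mM n : measurable_fun setT (M n).
Proof. exact: measurable_wrt_measurable (FT n) (running_max_adapted n). Qed.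

Let M0 n x : 0 <= M n x. Proof. exact: running_max_ge0. Qed.

Let mpow (g : T -> R) (r : R) : measurable_fun setT g ->
  measurable_fun setT (fun x => g x `^ r).
Proof. by move=> mg; exact: (@measurableT_comp _ _ _ _ _ _ (@powR R ^~ r)). Qed.

Let E_ge0 {u : T -> R} : (forall x, 0 <= u x) -> (0 <= 'E u)%E.
Proof. by move=> u0; apply: integral_ge0 => x _; rewrite lee_fin. Qed.

Let leE {u v : T -> R} : (forall x, 0 <= u x) ->
  measurable_fun setT u -> measurable_fun setT v ->
  (forall x, u x <= v x) -> ('E u <= 'E v)%E.
Proof.
move=> u0 mu' mv uv; apply: ge0_le_integral => //.
- by move=> x _; rewrite lee_fin.
- exact/measurable_EFinP/measurable_funTS.
- exact/measurable_EFinP/measurable_funTS.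
- by move=> x _; rewrite lee_fin.
Qed.

Let EZl (a : R) (u : T -> R) : 0 <= a -> (forall x, 0 <= u x) ->
  measurable_fun setT u -> 'E (fun x => a * u x) = (a%:E * 'E u)%E.
Proof.
move=> a0 u0 mu'; under eq_integral do rewrite EFinM.
rewrite ge0_integralZl ?lee_fin//; last by move=> x _; rewrite lee_fin.
exact/measurable_EFinP/measurable_funTS.
Qed.

Let E_lin (a b : R) (u v : T -> R) : 0 <= a -> 0 <= b ->
  (forall x, 0 <= u x) -> (forall x, 0 <= v x) ->
  measurable_fun setT u -> measurable_fun setT v ->
  'E (fun x => a * u x + b * v x) = (a%:E * 'E u + b%:E * 'E v)%E.
Proof.
move=> a0 b0 u0 v0 mu' mv; under eq_integral do rewrite EFinD.
have m (c : R) (w : T -> R) : measurable_fun setT w ->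
    measurable_fun A (fun x => (c * w x)%:E).
  move=> mw; apply/measurable_EFinP/measurable_funTS; exact: measurable_funM.
rewrite ge0_integralD//; [|by move=> x _; rewrite lee_fin mulr_ge0|exact: m
  |by move=> x _; rewrite lee_fin mulr_ge0|exact: m].
by rewrite !EZl.
Qed.

(** With all terms nonnegative, linearity holds even for infinite integrals; this is why the
    pathwise inequalities are arranged without subtracting integrands. *)
Let le_E_lin {a b a' b' : R} {u v u' v' : T -> R} :
  [/\ 0 <= a, 0 <= b, 0 <= a' & 0 <= b'] ->
  [/\ forall x, 0 <= u x, forall x, 0 <= v x,
      forall x, 0 <= u' x & forall x, 0 <= v' x] ->
  [/\ measurable_fun setT u, measurable_fun setT v,
      measurable_fun setT u' & measurable_fun setT v'] ->
  (forall x, a * u x + b * v x <= a' * u' x + b' * v' x) ->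
  (a%:E * 'E u + b%:E * 'E v <= a'%:E * 'E u' + b'%:E * 'E v')%E.
Proof.
move=> [a0 b0 a'0 b'0] [u0 v0 u'0 v'0] [mu' mv mu'' mv'] le.
rewrite -!E_lin//; apply: leE => //.
- by move=> x; rewrite addr_ge0 ?mulr_ge0.
- by apply: measurable_funD; exact: measurable_funM.
- by apply: measurable_funD; exact: measurable_funM.
Qed.

Let E_young {u v : T -> R} :
  (forall x, 0 <= u x) -> (forall x, 0 <= v x) ->
  measurable_fun setT u -> measurable_fun setT v ->
  (p%:E * 'E (fun x => (u x `^ (p - 1) * v x)%R)
   <= (p - 1)%:E * 'E (fun x => u x `^ p) + 'E (fun x => v x `^ p))%E.
Proof.
move=> u0 v0 mu' mv.
(* The left-hand side is padded with a zero multiple of an integral to fit the two-term form of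
   [le_E_lin]. *)
rewrite -[leLHS]adde0 -[X in (_ + X <= _)%E](mul0e ('E v)) -[X in (_ <= _ + X)%E]mul1e.
apply: le_E_lin; last by move=> x; rewrite mul0r addr0 mul1r young_powR.
- by split=> //; exact: ltW.
- by split=> // x; rewrite ?mulr_ge0 ?powR_ge0.
- by split=> //; [apply: measurable_funM => //| |]; exact: mpow.
Qed.

(** The weight [u ^ (p - 1)] is measurable for [F n], so it may be inserted into the submartingale
    inequality. *)
Let E_submart {n} {u : T -> R} : (forall x, 0 <= u x) -> measurable_wrt (F n) u ->
  ('E (fun x => (u x `^ (p - 1) * f n x)%R)
   <= 'E (fun x => (u x `^ (p - 1) * f n.+1 x)%R))%E.
Proof.
move=> u0 Fu; apply: (le_integral_mul_wrt (sF n)) (FA n) => //.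
- by move=> x; exact: powR_ge0.
- exact: measurable_wrt_powR.
- exact: le_f.
Qed.

Let E_fin {u : T -> R} : (forall x, 0 <= u x) -> ('E u < +oo)%E ->
  exists r, 'E u = r%:E.
Proof.
move=> u0 uoo; exists (fine ('E u)).
by rewrite fineK// ge0_fin_numE// E_ge0.
Qed.

Let E_powRB1 (u : T -> R) : (forall x, 0 <= u x) ->
  'E (fun x => (u x `^ (p - 1) * u x)%R) = 'E (fun x => u x `^ p).
Proof. by move=> u0; apply: eq_integral => x _; rewrite mulrC mulr_powRB1. Qed.

(** With the weight [f n ^ (p - 1)], the submartingale property and Young's inequality bound
    [p E(f_n^p)] by [(p-1) E(f_n^p) + E(f_{n+1}^p)]; the finite term [(p-1) E(f_n^p)] is then
    cancelled. *)
Lemma submartingale_moment_nd : nondecreasing_seq (fun n => 'E (fun x => f n x `^ p)).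
Proof.
apply/nondecreasing_seqP => n.
have young := E_young (f0 n) (f0 n.+1) (mf n) (mf n.+1).
have := E_submart (f0 n) (fF n); rewrite E_powRB1// => fK.
have {fK} : (p%:E * 'E (fun x => f n x `^ p) <=
    (p - 1)%:E * 'E (fun x => f n x `^ p) + 'E (fun x => f n.+1 x `^ p))%E.
  by apply: le_trans young; rewrite lee_wpmul2l// lee_fin ltW.
have [|a ->] := E_fin _ (f_lty n); first by move=> x; exact: powR_ge0.
have [|b ->] := E_fin _ (f_lty n.+1); first by move=> x; exact: powR_ge0.
by rewrite -!EFinM -EFinD !lee_fin mulrBl mul1r addrAC -addrA lerDl subr_ge0.
Qed.

(** By induction, since [M_{n+1}^p] is one of [M_n^p] and [f_{n+1}^p], hence at most their sum. *)
Let M_lty n : ('E (fun x => M n x `^ p) < +oo)%E.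
Proof.
elim: n => [|n IHn]; first exact: f_lty.
have pow0 g x : 0 <= (g : T -> R) x `^ p by exact: powR_ge0.
apply: (@le_lt_trans _ _ ('E (fun x => M n x `^ p) + 'E (fun x => f n.+1 x `^ p))%E).
  rewrite -[X in (X <= _)%E]mul1e -[X in (X <= _)%E]adde0.
  rewrite -[X in (_ + X <= _)%E](mul0e ('E (fun x => M n x `^ p))).
  rewrite -[X in (_ <= X + _)%E]mul1e -[X in (_ <= _ + X)%E]mul1e.
  apply: le_E_lin => //; first by split; exact: mpow.
  move=> x /=; rewrite mul0r addr0 !mul1r; case: (leP (M n x) (f n.+1 x)) => _.
    by rewrite lerDr.
  by rewrite lerDl.
by rewrite lte_add_pinfty.
Qed.

Lemma running_max_moment_le n :
  ((p - 1)%:E * 'E (fun x => M n x `^ p)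
   <= p%:E * 'E (fun x => (M n x `^ (p - 1) * f n x)%R))%E.
Proof.
have pow0 (g : T -> R) r x : 0 <= g x `^ r by exact: powR_ge0.
elim: n => [|n IHn].
  rewrite [X in (_ <= _ * X)%E]E_powRB1//; apply: lee_wpmul2r; first exact: E_ge0.
  by rewrite lee_fin gerBl.
have Mf0 k l x : 0 <= M k x `^ (p - 1) * f l x by rewrite mulr_ge0.
have mMf k l : measurable_fun setT (fun x => M k x `^ (p - 1) * f l x).
  by apply: measurable_funM => //; exact: mpow.
have step : ((p - 1)%:E * 'E (fun x => M n.+1 x `^ p) +
    p%:E * 'E (fun x => (M n x `^ (p - 1) * f n.+1 x)%R) <=
    p%:E * 'E (fun x => (M n.+1 x `^ (p - 1) * f n.+1 x)%R) +
    (p - 1)%:E * 'E (fun x => M n x `^ p))%E.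
  apply: le_E_lin => //; first by split; exact: ltW.
  - by split=> //; exact: mpow.
  - by move=> x; exact: running_max_step.
(* As [M n] is adapted, [f n] may be replaced by [f n.+1] in the induction hypothesis. *)
have {}IHn : ((p - 1)%:E * 'E (fun x => M n x `^ p)
   <= p%:E * 'E (fun x => (M n x `^ (p - 1) * f n.+1 x)%R))%E.
  apply: (le_trans IHn); apply: lee_wpmul2l; first by rewrite lee_fin ltW.
  exact: E_submart (running_max_adapted n).
have young k l := E_young (M0 k) (f0 l) (mM k) (mf l).
(* Young's inequality bounds the mixed integrals by finite moments. *)
have Mf_lty k l : ('E (fun x => (M k x `^ (p - 1) * f l x)%R) < +oo)%E.
  rewrite -(@lte_pmul2l _ p%:E)// ?lte_fin// gt0_muley ?lte_fin//.
  apply: le_lt_trans (young k l) _; rewrite lte_add_pinfty//.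
  by rewrite lte_mul_pinfty// lee_fin ltW.
(* The terms [E_A(M_n^p)] and [E_A(M_n^(p-1) f_{n+1})] only cancel because they
   are finite. *)
move: step IHn.
have [//|a ->] := E_fin _ (M_lty n); have [//|b ->] := E_fin _ (M_lty n.+1).
have [//|c ->] := E_fin _ (Mf_lty n n.+1).
have [//|e ->] := E_fin _ (Mf_lty n.+1 n.+1).
rewrite -!EFinM -!EFinD !lee_fin => step IHn.
by rewrite -(lerD2r (p * c)); apply: le_trans step _; rewrite lerD2l.
Qed.

(** Young's inequality is applied to [M n] and [c * f n]. Since [c (p-1) = p], the previous lemma
    turns it into [p E(M_n^p) <= (p-1) E(M_n^p) + c^p E(f_n^p)], where the finite term cancels. *)
Lemma doob_moment n :
  ('E (fun x => M n x `^ p)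
   <= ((p / (p - 1)) `^ p)%:E * 'E (fun x => f n x `^ p))%E.
Proof.
have pow0 (g : T -> R) r x : 0 <= g x `^ r by exact: powR_ge0.
pose c := p / (p - 1); have c0 : 0 < c by exact: divr_gt0.
have cf0 x : 0 <= c * f n x by rewrite mulr_ge0// ltW.
have mcf : measurable_fun setT (fun x => c * f n x) by exact: measurable_funM.
have := E_young (M0 n) cf0 (mM n) mcf.
have -> : 'E (fun x => (M n x `^ (p - 1) * (c * f n x))%R) =
    (c%:E * 'E (fun x => (M n x `^ (p - 1) * f n x)%R))%E.
  rewrite -EZl; [by apply: eq_integral => x _; rewrite mulrCA|exact: ltW| |].
    by move=> x; rewrite mulr_ge0.
  by apply: measurable_funM => //; exact: mpow.
have -> : 'E (fun x => (c * f n x) `^ p) =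
    ((c `^ p)%:E * 'E (fun x => f n x `^ p))%E.
  rewrite -EZl ?powR_ge0//; last exact: mpow.
  by apply: eq_integral => x _; rewrite powRM// ltW.
rewrite muleCA => young.
have {young} : (c%:E * ((p - 1)%:E * 'E (fun x => M n x `^ p)) <=
    (p - 1)%:E * 'E (fun x => M n x `^ p) + (c `^ p)%:E * 'E (fun x => f n x `^ p))%E.
  apply: le_trans young; apply: lee_wpmul2l; first by rewrite lee_fin ltW.
  exact: running_max_moment_le.
have [//|a ->] := E_fin _ (M_lty n); have [//|b ->] := E_fin _ (f_lty n).
rewrite -!EFinM -EFinD !lee_fin mulrA divfK ?gt_eqF// mulrBl mul1r addrAC.
by rewrite -addrA lerDl subr_ge0.
Qed.

(** Monotone convergence along [M n ^ p], with the bound at each [n] enlarged to the supremum of the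
    moments. *)
Lemma doob_moment_sup :
  (\int[mu]_(x in A) (ereal_sup (range (fun n => (f n x)%:E)) `^ p)
   <= ((p / (p - 1)) `^ p)%:E *
      ereal_sup (range (fun n => 'E (fun x => f n x `^ p))))%E.
Proof.
have nd_Mp x : nondecreasing_seq (fun n => (M n x `^ p)%:E).
  move=> m n mn; rewrite lee_fin ge0_ler_powR ?nnegrE//; first exact: ltW.
  exact: nondecreasing_running_max.
rewrite [leLHS](_ : _ = (\int[mu]_(x in A) limn (fun n => (M n x `^ p)%:E))%E).
  apply: (cvge_le _ (@cvg_monotone_convergence _ _ _ mu A mA
    (fun n x => (M n x `^ p)%:E) _ _ _)) => //.
  - apply: nearW => n; apply: (le_trans (doob_moment n)).
    rewrite lee_wpmul2l ?lee_fin ?powR_ge0//.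
    by apply: ereal_sup_ubound; exists n.
  - by move=> n; apply/measurable_EFinP/measurable_funTS; exact: mpow.
  - by move=> n x _; rewrite lee_fin powR_ge0.
apply: eq_integral => x _.
rewrite -ereal_sup_running_max (poweR_ereal_sup 0%N)//; last first.
  by move=> n; rewrite lee_fin.
by apply/esym/cvg_lim => //; exact: ereal_nondecreasing_cvgn (nd_Mp x).
Qed.

End doob.

(** * Sums of nonnegative families *)

(** The sum is a supremum over finite subsets, and on a finite subset the limit of the nondecreasing
    sequences commutes with the sum. *)
Lemma esum_ereal_sup {R : realType} {I : choiceType} (S : set I)
    (u : nat -> I -> \bar R) :
  (forall n i, 0 <= u n i)%E -> (forall i, nondecreasing_seq (u ^~ i)) ->
  (\esum_(i in S) ereal_sup (range (u ^~ i))
   <= ereal_sup (range (fun n => \esum_(i in S) u n i)))%E.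
Proof.
move=> u0 nd; apply: ge_ereal_sup => _ [X [finX XS] <-].
rewrite fsbig_finite//=.
have : (\sum_(i <- finmap.enum_fset (fset_set X)) u n i)%E @[n --> \oo] -->
    (\sum_(i <- finmap.enum_fset (fset_set X)) ereal_sup (range (u ^~ i)))%E.
  apply: cvg_nnesum => i _; first exact: nearW.
  exact: ereal_nondecreasing_cvgn.
apply: cvge_le; apply: nearW => n.
apply: (@le_trans _ _ (\esum_(i in S) u n i)%E).
  by apply: ereal_sup_ubound; exists X => //; rewrite fsbig_finite.
by apply: ereal_sup_ubound; exists n.
Qed.

Lemma le_esum_mull {R : realType} {I : choiceType} (S : set I) (k : \bar R)
    (u : I -> \bar R) : (0 <= k)%E -> (forall i, 0 <= u i)%E ->
  (\esum_(i in S) (k * u i) <= k * \esum_(i in S) u i)%E.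
Proof.
move=> k0 u0; apply: ge_ereal_sup => _ [X [finX XS] <-].
rewrite -ge0_mule_fsumr//; apply: lee_wpmul2l => //.
by apply: ereal_sup_ubound; exists X.
Qed.

(** * The dyadic filtration *)

Section dyadic_filtration.
Context {R : realType}.
Local Notation F := (@dyadic_salgebra R).

Lemma dyadic_salgebraP n : sigma_algebra setT (F n).
Proof. exact: smallest_sigma_algebra. Qed.

Lemma dyadic_salgebra_measurable n :
  F n `<=` (@measurable _ (dyadic_real R)).
Proof. by move=> A FA; apply: sub_sigma_algebra; exists n. Qed.

(** Halving an interval at its midpoint; this makes the filtration increasing. *)
Lemma dyadic_intervalU n k :
  @dyadic_interval R n k =
  @dyadic_interval R n.+1 (2 * k) `|` @dyadic_interval R n.+1 (2 * k + 1).
Proof.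
have half (m : int) : (2 * m)%:~R / 2 ^+ n.+1 = m%:~R / 2 ^+ n :> R.
  by rewrite intrM exprS -mulf_div divff ?mul1r// pnatr_eq0.
rewrite /dyadic_interval -half.
have -> : (k + 1)%:~R / 2 ^+ n = ((2 * k + 1) + 1)%:~R / 2 ^+ n.+1 :> R.
  by rewrite -half mulrDr mulr1 -addrA.
by rewrite -itv_bndbnd_setU// bnd_simp ler_pM2r ?invr_gt0 ?exprn_gt0// ler_int lerDl.
Qed.

Lemma dyadic_salgebra_nd n : F n `<=` F n.+1.
Proof.
apply: smallest_sub; first exact: dyadic_salgebraP.
move=> _ [k _ <-]; rewrite dyadic_intervalU.
apply: (@measurableU _ (g_sigma_algebraType (range (@dyadic_interval R n.+1)))).
  by apply: sub_sigma_algebra; exists (2 * k).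
by apply: sub_sigma_algebra; exists (2 * k + 1).
Qed.

Lemma dyadic_salgebra_unit_interval j : F 0%N (@unit_interval R j).
Proof.
by apply: sub_sigma_algebra; exists j; rewrite // /dyadic_interval expr0 !divr1.
Qed.

End dyadic_filtration.

(** * The submartingale property in integrated form *)

Lemma submartingale_le_integral {d} {T : measurableType d} {R : realType}
    (P : probability T R) (F : nat -> set (set T)) (f : nat -> T -> R) :
  (forall n, F n `<=` measurable) -> (forall n x, 0 <= f n x) ->
  submartingale P F f -> forall n B, F n B ->
  (\int[P]_(x in B) (f n x)%:E <= \int[P]_(x in B) (f n.+1 x)%:E)%E.
Proof.
move=> FT f0 [fF _ fE] n B FB; have mB : measurable B := FT _ _ FB.
have [g [Fg _ <-//] fg] := fE n.
have mf := measurable_wrt_measurable (FT n) (fF n).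
have mg := measurable_wrt_measurable (FT n) Fg.
have mfg : measurable_fun setT (fun x => Num.max (f n x) (g x)).
  exact: measurable_maxr.
(* The version [g] dominates [f n] only almost everywhere. Its maximum with [f n] dominates
   everywhere and has the same integral. *)
rewrite [leRHS](_ : _ = \int[P]_(x in B) (Num.max (f n x) (g x))%:E)%E.
  apply: ge0_le_integral => //.
  - by move=> x _; rewrite lee_fin.
  - exact/measurable_EFinP/measurable_funTS.
  - exact/measurable_EFinP/measurable_funTS.
  - by move=> x _; rewrite lee_fin le_max lexx.
apply: ae_eq_integral => //.
- exact/measurable_EFinP/measurable_funTS.
- exact/measurable_EFinP/measurable_funTS.
- by apply: filterS fg => x fgx _; rewrite max_r.
Qed.

(** * From local moments to the amalgam norm *)

Theorem theorem3p2 (R : realType) (P : probability (dyadic_real R) R)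
    (p : R) (q : \bar R) (f : nat -> dyadic_real R -> R)
    (hq : (0 < q)%E) (hp : 1 < p)
    (f_ge0 : forall n x, 0 <= f n x)
    (f_sub : submartingale P (@dyadic_salgebra R) f)
    (f_bnd : (ereal_sup (range (fun n => amalgam_norm P p q (EFin \o f n)))
              < +oo)%E) :
  (amalgam_norm P p q (fun x => ereal_sup (range (fun n => (f n x)%:E)))
   <= (p / (p - 1))%:E *
      ereal_sup (range (fun n => amalgam_norm P p q (EFin \o f n))))%E.
Proof.
have p0 : 0 < p := lt_trans ltr01 hp.
have pV0 : 0 < p^-1 by rewrite invr_gt0.
pose c := p / (p - 1).
have c0 : 0 <= c by rewrite divr_ge0 ?subr_ge0// ltW.
rewrite -/c; set N := fun n => amalgam_norm P p q (EFin \o f n).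
have N_lty n : (N n < +oo)%E.
  by apply: le_lt_trans f_bnd; apply: ereal_sup_ubound; exists n.
pose a n j := (\int[P]_(x in @unit_interval R j) (f n x `^ p)%:E)%E.
pose s j := (\int[P]_(x in @unit_interval R j)
  (ereal_sup (range (fun n => (f n x)%:E)) `^ p))%E.
have a0 n j : (0 <= a n j)%E.
  by apply: integral_ge0 => x _; rewrite lee_fin powR_ge0.
have s0 j : (0 <= s j)%E by apply: integral_ge0 => x _; exact: poweR_ge0.
have sup_a0 j : (0 <= ereal_sup (range (a ^~ j)))%E.
  by apply: le_trans (a0 0%N j) _; apply: ereal_sup_ubound; exists 0%N.
have aE n j : (\int[P]_(x in @unit_interval R j)
    (`|(EFin \o f n) x| `^ p))%E = a n j.
  by apply: eq_integral => x _; rewrite /= ger0_norm.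
have sE j : (\int[P]_(x in @unit_interval R j)
    (`|ereal_sup (range (fun n => (f n x)%:E))| `^ p))%E = s j.
  apply: eq_integral => x _; rewrite gee0_abs//.
  apply: (@le_trans _ _ (f 0%N x)%:E); first by rewrite lee_fin.
  by apply: ereal_sup_ubound; exists 0%N.
(* Finiteness of the local moments stays a premise here: it is derived from the norm bound
   separately for finite and infinite [q]. *)
have a_nd j : (forall n, (a n j < +oo)%E) -> nondecreasing_seq (a ^~ j).
  apply: submartingale_moment_nd => //.
  - exact: dyadic_salgebraP.
  - exact: dyadic_salgebra_measurable.
  - exact: dyadic_salgebra_nd.
  - by case: f_sub.
  - by apply: submartingale_le_integral f_sub; [exact: dyadic_salgebra_measurable|].
  - exact: dyadic_salgebra_unit_interval.
have doob j : (forall n, (a n j < +oo)%E) ->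
    (s j <= (c `^ p)%:E * ereal_sup (range (a ^~ j)))%E.
  apply: doob_moment_sup => //.
  - exact: dyadic_salgebraP.
  - exact: dyadic_salgebra_measurable.
  - exact: dyadic_salgebra_nd.
  - by case: f_sub.
  - by apply: submartingale_le_integral f_sub; [exact: dyadic_salgebra_measurable|].
  - exact: dyadic_salgebra_unit_interval.
case: q hq @N f_bnd N_lty => [r| |]// hr N _ N_lty.
- rewrite lte_fin in hr.
  have rp0 : 0 < r / p by rewrite divr_gt0.
  have NE n : N n = ((\esum_(j in [set: int]) (a n j `^ (r / p))) `^ r^-1)%E.
    by rewrite /N /amalgam_norm; under eq_esum do rewrite aE.
  have sum0 n : (0 <= \esum_(j in [set: int]) (a n j `^ (r / p)))%E.
    by apply: esum_ge0 => j _; exact: poweR_ge0.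
  (* A single term is at most the whole sum, which is finite because its power [N n] is. *)
  have a_lty j n : (a n j < +oo)%E.
    apply: (@lty_poweRy _ _ (r / p)); first exact: lt0r_neq0.
    apply: (@le_lt_trans _ _ (\esum_(j in [set: int]) (a n j `^ (r / p)))%E).
      apply: esum_ge; exists [set j]; first by split.
      by rewrite fsbig_set1.
    apply: (@lty_poweRy _ _ r^-1); first by rewrite invr_eq0 lt0r_neq0.
    by rewrite -NE.
  have -> : N = fun n => ((\esum_(j in [set: int]) (a n j `^ (r / p))) `^ r^-1)%E.
    exact/funext.
  have rV0 : 0 < r^-1 by rewrite invr_gt0.
  rewrite -(poweR_ereal_sup 0%N _ _ rV0 sum0).
  (* The constant is moved under the outer power, so that it remains to compare sums. *)
  have -> : (c%:E = (c `^ r)%:E `^ r^-1)%E.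
    by rewrite -poweR_EFin poweRK ?gt_eqF// lee_fin.
  have supsum0 : (0 <= ereal_sup (range (fun n =>
      \esum_(j in [set: int]) (a n j `^ (r / p)))))%E.
    by apply: le_trans (sum0 0%N) _; apply: ereal_sup_ubound; exists 0%N.
  rewrite -poweRM// ?lee_fin ?powR_ge0// /amalgam_norm.
  under eq_esum do rewrite sE.
  apply: le_poweR; first by rewrite invr_ge0 ltW.
    by apply: esum_ge0 => j _; exact: poweR_ge0.
  apply: (@le_trans _ _ (\esum_(j in [set: int]) ((c `^ r)%:E *
      ereal_sup (range (fun n => a n j `^ (r / p)))))%E).
    apply: le_esum => j _.
    (* This matches the constant [c ^ p] of Doob's inequality, raised to the power [r / p]. *)
    have -> : ((c `^ r)%:E = (c `^ p)%:E `^ (r / p))%E.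
      by rewrite poweR_EFin -powRrM mulrC divfK// gt_eqF.
    rewrite -(poweR_ereal_sup 0%N)// -poweRM ?lee_fin ?powR_ge0//.
    by apply: le_poweR; [exact: ltW|exact: s0|exact: doob].
  apply: le_trans (le_esum_mull _ _ _ _ _) _; first by rewrite lee_fin powR_ge0.
    by move=> j; rewrite -(poweR_ereal_sup 0%N)//; exact: poweR_ge0.
  apply: lee_wpmul2l; first by rewrite lee_fin powR_ge0.
  apply: esum_ereal_sup => [n j|j m n mn]; first exact: poweR_ge0.
  by apply: le_poweR; [exact: ltW|exact: a0|exact: a_nd].
(* For infinite [q] the norm is a supremum over [j], so it suffices to take [p]-th roots in Doob's
   inequality on each interval. *)
- have NE n j : (a n j `^ p^-1 <= N n)%E.
    by apply: ereal_sup_ubound; exists j => //; rewrite aE.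
  have a_lty j n : (a n j < +oo)%E.
    apply: (@lty_poweRy _ _ p^-1); first exact: lt0r_neq0.
    exact: le_lt_trans (NE n j) (N_lty n).
  apply: ge_ereal_sup => _ [j _ <-]; rewrite sE.
  apply: (le_trans (le_poweR _ _ _ (ltW pV0) (s0 j) (doob j (a_lty j)))).
  rewrite poweRM ?lee_fin ?powR_ge0// -poweR_EFin poweRK ?gt_eqF ?lee_fin//.
  apply: lee_wpmul2l; first by rewrite lee_fin.
  rewrite (poweR_ereal_sup 0%N)//; apply: ge_ereal_sup => _ [n _ <-].
  by apply: le_trans (NE n j) _; apply: ereal_sup_ubound; exists n.
Qed.
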